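(* Let $S$ be a finite semigroup with $S^2=S$ all of whose idempotents are central, and let $K$ be a field. View the algebra $\prod_{e\in E(S)}K_0\widetilde H_e^0$ as having $K$-basis the disjoint union of the sets $\widetilde H_e$, $e\in E(S)$, which is $S$. Then the $K$-linear mapping $$Z\colon KS\to\prod_{e\in E(S)}K_0\widetilde H_e^0,\qquad Z(s)=\sum_{t\leq s}t\quad(s\in S),$$ is an isomorphism of $K$-algebras. In particular, $KS$ is unital.
   Context: $E(S)$ is the set of idempotents of $S$, ordered by $e\leq f$ if $ef=e$. For $s\in S$, the set of $e\in E(S)$ with $se=s$ is a nonempty subsemigroup of the commutative semigroup $E(S)$, so has a unique minimum element, denoted $s^+$. Put $\widetilde H_e=\{s\in S\mid s^+=e\}$ for $e\in E(S)$; these sets partition $S$. The monoid $\widetilde H_e^0=\widetilde H_e\cup\{z\}$ has identity $e$, zero $z$, and product of $a,b\in\widetilde H_e$ equal to $ab$ (product in $S$) if $ab\in\widetilde H_e$ and $z$ otherwise. The partial order on $S$ is: $s\leq t$ if $s=te$ for some $e\in E(S)$. For a semigroup $T$ with zero $z$, the contracted semigroup algebra is $K_0T=KT/Kz$; it has basis $T\setminus\{z\}$, with the zero of $T$ identified with the zero of the algebra. Thus in $\prod_{e}K_0\widetilde H_e^0$ the product of basis elements $s,t\in S$ is $st$ if $s^+=t^+=(st)^+$ and $0$ otherwise. *)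

(* Defs.v *)
From HB Require Import structures.
From mathcomp Require Import all_boot all_order all_algebra.
From mathcomp Require Import zify.

Set Implicit Arguments.
Unset Strict Implicit.
Unset Printing Implicit Defensive.

Import GRing.Theory.
Local Open Scope ring_scope.

#[short(type="finMagmaType")]
HB.structure Definition FinMagma := {G of Magma G & Finite G}.

#[short(type="finSemigroupType")]
HB.structure Definition FinSemigroup := {G of Semigroup G & Finite G}.

Section Semigroup.
Variable S : finSemigroupType.
Implicit Types e f s t : S.

Definition idem : {set S} := [set e : S | (e * e)%g == e].

Definition idem_le e f : bool := (e * f)%g == e.

Definition right_ids s : {set S} := [set e in idem | (s * e)%g == s].

(* s^+; the default value s is never reached when S ^ 2 = S and all
   idempotents are central, see plusP. *)
Definition plus s : S :=
  odflt s [pick e in right_ids s | [forall f in right_ids s, idem_le e f]].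

Definition Htilde e : {set S} := [set s | plus s == e].

Definition sle s t : bool := [exists e in idem, s == (t * e)%g].

(* The zero z is None, and the product of a, b is a b or z; see Htilde0_mulA
   and Htilde0_mule for the monoid laws. *)
Definition Htilde0 e : Type := option {s : S | s \in Htilde e}.

HB.instance Definition _ e := Finite.on (Htilde0 e).

(* insub s is Some s if s \in Htilde e, and None otherwise. *)
Definition Htilde0_mul e (a b : Htilde0 e) : Htilde0 e :=
  match a, b with
  | Some a', Some b' => insub (val a' * val b')%g
  | _, _ => None
  end.

HB.instance Definition _ e := hasMul.Build (Htilde0 e) (@Htilde0_mul e).

End Semigroup.

Section PlusTheory.
Variable S : finSemigroupType.
Hypothesis S_square : forall s : S, exists a b : S, s = (a * b)%g.
Hypothesis idem_central :
  forall e s : S, e \in idem S -> (e * s)%g = (s * e)%g.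
Implicit Types e f s t : S.

Lemma idem_power (w : S) : exists k, iter k (fun x => w * x)%g w \in idem S.
Proof.
pose p k := iter k (fun x => w * x)%g w.
have pD i j : (p i * p j)%g = p (i + j).+1.
  by elim: i => [//|i IHi]; rewrite addSn /= -mulgA [(_ * p j)%g]IHi.
have [i [d pid]] : exists i d, p i = p (i + d).+1.
  have /injectivePn[x [y xy pxy]] : ~~ injectiveb (fun i : 'I_#|S|.+1 => p i).
    apply/negP => /injectiveP /leq_card; by rewrite card_ord ltnn.
  have [lt|lt|/val_inj eq] := ltngtP x y; last by rewrite eq eqxx in xy.
    by exists x, (y - x).-1; rewrite pxy; congr p; rewrite -addnS prednK ?subn_gt0 // subnKC // ltnW.
  by exists y, (x - y).-1; rewrite -pxy; congr p; rewrite -addnS prednK ?subn_gt0 // subnKC // ltnW.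
have per j : (i <= j)%N -> p (j + d).+1 = p j.
  move=> /subnKC <-; case: (j - i)%N => [|m]; first by rewrite addn0 -pid.
  have -> : p (i + m.+1)%N = (p i * p m)%g by rewrite addnS pD.
  by rewrite pid pD; congr p; lia.
have perM j m : (i <= j)%N -> p (j + m * d.+1)%N = p j.
  move=> ij; elim: m => [|m IHm]; first by rewrite addn0.
  have -> : (j + m.+1 * d.+1 = (j + m * d.+1 + d).+1)%N by lia.
  by rewrite per ?IHm // (leq_trans ij) ?leq_addr.
exists (i + i * d + d)%N; rewrite inE [X in X == _]pD.
have -> : (i + i * d + d + (i + i * d + d)).+1 =
          ((i + i * d + d) + i.+1 * d.+1)%N by lia.
by rewrite perM // -addnA leq_addr.
Qed.

Lemma right_ids_neq0 s : exists e, e \in right_ids s.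
Proof.
have Sb t : exists a, [exists b, t == (a * b)%g].
  by have [a [b tab]] := S_square t; exists a; apply/existsP; exists b; apply/eqP.
pose f t := xchoose (Sb t).
have fP t : exists u, t = (f t * u)%g 
  by have /existsP[u /eqP tu] := xchooseP (Sb t); exists u.
have step i d t : exists u, iter i f t = (iter (i + d).+1 f t * u)%g.
  elim: d => [|d [u ->]]; first by rewrite addn0; exact: fP.
  have [v {1}->] := fP (iter (i + d).+1 f t).
  by exists (v * u)%g; rewrite mulgA addnS.
have pre j t : t = iter j f t \/ exists u, t = (iter j f t * u)%g.
  case: j => [|j]; [by left | right].
  by have [u eu] := step 0%N j t; exists u.
have [j [w pw]] : exists j w, iter j f s = (iter j f s * w)%g.
  have /injectivePn[x [y xy pxy]] :
      ~~ injectiveb (fun i : 'I_#|S|.+1 => iter i f s).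
    apply/negP => /injectiveP /leq_card; by rewrite card_ord ltnn.
  have main (i j : nat) : (i < j)%N -> iter i f s = iter j f s ->
      exists w, iter i f s = (iter i f s * w)%g.
    move=> ij eij; have [u] := step i (j - i).-1 s.
    by rewrite -addnS prednK ?subn_gt0 // subnKC 1?ltnW // -eij; exists u.
  have [lt|lt|/val_inj eq] := ltngtP x y; last by rewrite eq eqxx in xy.
    by exists x; apply: main lt _.
  by exists y; apply: main lt _; rewrite pxy.
set p := iter j f s in pw.
have [k kE] := idem_power w; exists (iter k (fun x => w * x)%g w).
have pe : (p * iter k (fun x => w * x) w)%g = p.
  move: p pw => p pw; elim: k {kE} => [|k IHk] /=; first exact/esym.
  by rewrite mulgA -pw.
rewrite inE kE; apply/eqP; have [-> //|[u ->]] := pre j s.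
by rewrite -/p -mulgA -(idem_central u kE) mulgA pe.
Qed.

Lemma plusP s : [/\ plus s \in idem S, (s * plus s)%g = s
  & forall f, f \in idem S -> (s * f)%g = s -> idem_le (plus s) f].
Proof.
rewrite /plus; case: pickP => [e /=|noe].
  rewrite inE => /andP[/andP[eE /eqP se] /forall_inP emin]; split=> // f fE sf.
  by apply: emin; rewrite inE fE sf /=.
have [e0 e0s] := right_ids_neq0 s.
pose low e := [set f in idem S | idem_le f e].
case: (arg_minnP (fun e => #|low e|) e0s) => e es emin.
have {}es : e \in right_ids s := es.
have /idP[] := noe e; rewrite /= es; apply/forall_inP => f fs.
have [] : (e \in idem S /\ (s * e)%g = s) /\ (f \in idem S /\ (s * f)%g = s).
  by move: es fs; rewrite !inE => /andP[-> /eqP->] /andP[-> /eqP->].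
move=> [eE se] [fE sf]; have ee : (e * e)%g = e by move: eE; rewrite inE => /eqP.
have ff : (f * f)%g = f by move: fE; rewrite inE => /eqP.
have ef : (e * f)%g \in right_ids s.
  rewrite inE mulgA se sf eqxx andbT inE mulgA -[(e * f * e)%g]mulgA.
  by rewrite (idem_central _ fE) mulgA ee -mulgA ff.
have efe : (e * f * e)%g = (e * f)%g.
  by rewrite -mulgA -(idem_central f eE) mulgA ee.
have sub : low (e * f)%g \subset low e.
  apply/subsetP => g; rewrite !inE => /andP[-> /eqP gef] /=.
  by rewrite /idem_le -{1}gef -mulgA efe gef.
have /eqP eq : low (e * f)%g == low e by rewrite eqEcard sub emin.
have : e \in low e by rewrite inE eE /idem_le ee /=.
by rewrite -eq inE /idem_le mulgA ee => /andP[].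
Qed.

Lemma plus_uniq s e : e \in right_ids s ->
  (forall f, f \in right_ids s -> idem_le e f) -> plus s = e.
Proof.
have [pE sp pmin] := plusP s.
move=> es emin; have ep : idem_le e (plus s) by rewrite emin // inE pE sp /=.
move: es; rewrite inE => /andP[eE /eqP se].
by rewrite -(eqP (pmin e eE se)) -idem_central // (eqP ep).
Qed.

Lemma idem_leP e f : e \in idem S -> reflect (f * e = e)%g (idem_le e f).
Proof. by move=> eE; rewrite -idem_central //; apply: eqP. Qed.

Lemma idem_le_anti e f : e \in idem S -> idem_le e f -> idem_le f e -> e = f.
Proof. by move=> eE /eqP ef /eqP fe; rewrite -ef idem_central. Qed.

Lemma plus_mull s t : idem_le (plus (s * t)%g) (plus s).
Proof.
have [aE aa _] := plusP s; have [_ _ min] := plusP (s * t)%g.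
by apply: min; rewrite // -mulgA -(idem_central t aE) mulgA aa.
Qed.

Lemma plus_mulr s t : idem_le (plus (s * t)%g) (plus t).
Proof.
have [bE bb _] := plusP t; have [_ _ min] := plusP (s * t)%g.
by apply: min; rewrite // -mulgA bb.
Qed.

Lemma plus_idem e : e \in idem S -> plus e = e.
Proof.
move=> eE; apply: plus_uniq.
  by rewrite inE eE /=; move: eE; rewrite inE.
by move=> f; rewrite inE => /andP[].
Qed.

Lemma plus_prefix r s t :
  plus (r * s * t)%g = plus r -> plus (r * s)%g = plus r.
Proof.
move=> rst; have [rsE _ _] := plusP (r * s)%g.
by apply: idem_le_anti => //; rewrite -?rst; [rewrite rst|]; apply: plus_mull.
Qed.

Lemma plus_suffix r s t :
  plus (r * (s * t))%g = plus t -> plus (s * t)%g = plus t.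
Proof.
move=> rst; have [stE _ _] := plusP (s * t)%g.
by apply: idem_le_anti => //; rewrite -?rst; [rewrite rst|]; apply: plus_mulr.
Qed.

Fact Htilde0_mulA e : associative (@Htilde0_mul S e).
Proof.
move=> [a|] [b|] [c|] //=; last by rewrite /Htilde0_mul /=; case: insub.
rewrite /Htilde0_mul /=; move: (valP a) (valP c); rewrite !inE => /eqP ea /eqP ec.
case: (insubP _ (val b * val c)%g) => [bc _ -> | bc];
  case: (insubP _ (val a * val b)%g) => [ab _ -> | ab] //=.
- by rewrite mulgA.
- rewrite mulgA insubN //; apply: contra ab; rewrite !inE => /eqP abc.
  by rewrite (@plus_prefix _ _ (val c)) ?ea ?abc.
- rewrite -mulgA insubN //; apply: contra bc; rewrite !inE => /eqP abc.
  by rewrite (@plus_suffix (val a)) ?ec ?abc.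
Qed.

Fact Htilde0_mule e : e \in idem S ->
  left_id (insub e) (@Htilde0_mul S e) /\ right_id (insub e) (@Htilde0_mul S e).
Proof.
move=> eE; have eH : e \in Htilde e by rewrite inE plus_idem.
have -> : (insub e : Htilde0 e) = Some (Sub e eH) by exact: insubT.
have eA (a : {s : S | s \in Htilde e}) : (val a * e)%g = val a.
  have [_ + _] := plusP (val a).
  by move: (valP a); rewrite inE => /eqP ->.
split=> -[a|] //.
  by rewrite -[RHS](valK a) -[in RHS](eA a) -(idem_central (val a) eE).
by rewrite -[RHS](valK a) -[in RHS](eA a).
Qed.

End PlusTheory.

Section SemigroupAlgebra.
Variables (K : fieldType) (T : finMagmaType).

Definition salg : Type := {ffun T -> K^o}.
HB.instance Definition _ := GRing.Lmodule.on salg.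

Definition sbasis (t : T) : salg := [ffun u => (u == t)%:R].

Definition salg_mul (x y : salg) : salg :=
  \sum_(a : T) \sum_(b : T) (x a * y b) *: sbasis (a * b)%g.

Lemma sbasis_mul s t : salg_mul (sbasis s) (sbasis t) = sbasis (s * t)%g.
Proof.
rewrite /salg_mul (bigD1 s) //= [X in _ + X]big1 => [|a /negPf as_].
  rewrite addr0 (bigD1 t) //= [X in _ + X]big1 => [|b /negPf bt].
    by rewrite addr0 !ffunE !eqxx mulr1 scale1r.
  by rewrite !ffunE bt mulr0 scale0r.
by apply: big1 => b _; rewrite !ffunE as_ mul0r scale0r.
Qed.

Lemma salgE (x : salg) : x = \sum_t x t *: sbasis t.
Proof.
apply/ffunP => u; rewrite sum_ffunE (bigD1 u) //= !ffunE eqxx big1 ?addr0.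
  by rewrite [_ *: _]mulr1.
by move=> t /negPf tu; rewrite !ffunE eq_sym tu scaler0.
Qed.

End SemigroupAlgebra.

(* K_0 T is the quotient KT / Kz, realized on the functions on T minus z with
   quotient map contract; contract_mul, contract_onto and contract_ker show
   that this is the quotient algebra. *)
Section ContractedAlgebra.
Variables (K : fieldType) (T : finMagmaType) (z : T).

Definition calg : Type := {ffun {t : T | t != z} -> K^o}.
HB.instance Definition _ := GRing.Lmodule.on calg.

Definition cbasis (t : T) : calg := [ffun u => (val u == t)%:R].

Definition calg_mul (x y : calg) : calg :=
  \sum_a \sum_b (x a * y b) *: cbasis (val a * val b)%g.

Definition contract (x : salg K T) : calg := [ffun u => x (val u)].

Lemma contract_linear : linear contract.
Proof. by move=> k x y; apply/ffunP => u; rewrite !ffunE. Qed.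

HB.instance Definition _ :=
  GRing.isLinear.Build K (salg K T) calg *:%R contract contract_linear.

Lemma contract_sbasis t : contract (sbasis K t) = cbasis t.
Proof. by apply/ffunP => u; rewrite !ffunE. Qed.

Lemma contract_onto (y : calg) : exists x, contract x = y.
Proof.
exists [ffun t => oapp y 0 (insub t)]; apply/ffunP => u.
by rewrite !ffunE valK.
Qed.

Lemma contract_ker (x : salg K T) :
  contract x = 0 <-> exists k, x = k *: sbasis K z.
Proof.
split=> [x0|[k ->]]; last first.
  apply/ffunP => u; rewrite !ffunE (negPf (valP u)); exact: scaler0.
exists (x z); apply/ffunP => t; rewrite !ffunE.
have [->|tz] := eqVneq t z; first by rewrite [_ *: _]mulr1.
by have /ffunP/(_ (Sub t tz)) := x0; rewrite !ffunE /= scaler0.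
Qed.

Lemma cbasis0 : cbasis z = 0.
Proof. by apply/ffunP => u; rewrite !ffunE (negPf (valP u)). Qed.

Lemma sum_nonzero (V : nmodType) (F : T -> V) : F z = 0 ->
  \sum_t F t = \sum_(u : {t : T | t != z}) F (val u).
Proof.
by move=> Fz; rewrite (bigD1 z) //= Fz add0r; exact: (big_sub (predC1 z)).
Qed.

Hypotheses (mul0z : forall t : T, (z * t)%g = z)
  (mulz0 : forall t : T, (t * z)%g = z).

Lemma contract_mul :
  {morph contract : x y / salg_mul x y >-> calg_mul x y}.
Proof.
move=> x y; rewrite /salg_mul /calg_mul linear_sum sum_nonzero.
  apply: eq_bigr => u _; rewrite linear_sum sum_nonzero.
    by apply: eq_bigr => v _; rewrite linearZ /= contract_sbasis !ffunE.
  by rewrite mulz0 linearZ /= contract_sbasis cbasis0 scaler0.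
rewrite linear_sum big1 // => b _.
by rewrite mul0z linearZ /= contract_sbasis cbasis0 scaler0.
Qed.

Lemma cbasis_mul s t : calg_mul (cbasis s) (cbasis t) = cbasis (s * t)%g.
Proof. by rewrite -!contract_sbasis -contract_mul sbasis_mul. Qed.

End ContractedAlgebra.

Section DirectProduct.
Variables (K : fieldType) (I : finType) (V : I -> lmodType K).

Definition dprod : Type := {dffun forall i, V i}.
HB.instance Definition _ := Choice.on dprod.
Implicit Types x y z : dprod.

Definition dprod_add x y : dprod := [ffun i => x i + y i].
Definition dprod_zero : dprod := [ffun i => 0].
Definition dprod_opp x : dprod := [ffun i => - x i].
Definition dprod_scale (k : K) x : dprod := [ffun i => k *: x i].

Fact dprod_addA : associative dprod_add.
Proof. by move=> x y z; apply/ffunP => i; rewrite !ffunE addrA. Qed.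
Fact dprod_addC : commutative dprod_add.
Proof. by move=> x y; apply/ffunP => i; rewrite !ffunE addrC. Qed.
Fact dprod_add0 : left_id dprod_zero dprod_add.
Proof. by move=> x; apply/ffunP => i; rewrite !ffunE add0r. Qed.
Fact dprod_addN : left_inverse dprod_zero dprod_opp dprod_add.
Proof. by move=> x; apply/ffunP => i; rewrite !ffunE addNr. Qed.

HB.instance Definition _ := GRing.isZmodule.Build dprod
  dprod_addA dprod_addC dprod_add0 dprod_addN.

Fact dprod_scaleA a b x : dprod_scale a (dprod_scale b x) = dprod_scale (a * b) x.
Proof. by apply/ffunP => i; rewrite !ffunE scalerA. Qed.
Fact dprod_scale1 : left_id 1 dprod_scale.
Proof. by move=> x; apply/ffunP => i; rewrite !ffunE scale1r. Qed.
Fact dprod_scaleDr : right_distributive dprod_scale +%R.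
Proof. by move=> a x y; apply/ffunP => i; rewrite !ffunE scalerDr. Qed.
Fact dprod_scaleDl x : {morph dprod_scale^~ x : a b / a + b}.
Proof. by move=> a b; apply/ffunP => i; rewrite !ffunE scalerDl. Qed.

HB.instance Definition _ := GRing.Zmodule_isLmodule.Build K dprod
  dprod_scaleA dprod_scale1 dprod_scaleDr dprod_scaleDl.

Lemma dprodDE x y i : (x + y) i = x i + y i. Proof. by rewrite ffunE. Qed.
Lemma dprodZE (k : K) x i : (k *: x) i = k *: x i. Proof. by rewrite ffunE. Qed.
Lemma dprod0E i : (0 : dprod) i = 0. Proof. by rewrite ffunE. Qed.

Lemma dprod_sumE (J : Type) (r : seq J) (P : pred J) (F : J -> dprod) i :
  (\sum_(j <- r | P j) F j) i = \sum_(j <- r | P j) F j i.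
Proof.
by elim/big_rec2: _ => [|j y x _ <-]; rewrite ?dprod0E // dprodDE.
Qed.

End DirectProduct.

Section Z.
Variables (K : fieldType) (S : finSemigroupType).

Definition Htilde_alg : Type :=
  dprod (fun e : {e : S | e \in idem S} =>
    calg K (None : Htilde0 (val e)) : lmodType K).
HB.instance Definition _ := GRing.Lmodule.on Htilde_alg.

Definition Htilde_alg_mul (x y : Htilde_alg) : Htilde_alg :=
  [ffun e => calg_mul (x e) (y e)].

(* The element t of S viewed in the product: t in the factor of index t^+ and
   0 in the others, where insub t = None. See pbasis_basis and pbasis_mul. *)
Definition pbasis (t : S) : Htilde_alg :=
  [ffun e => cbasis K (None : Htilde0 (val e)) (insub t)].

Definition Z (x : salg K S) : Htilde_alg :=
  \sum_(s : S) x s *: \sum_(t : S | sle t s) pbasis t.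

Lemma Z_sbasis s : Z (sbasis K s) = \sum_(t : S | sle t s) pbasis t.
Proof.
rewrite /Z (bigD1 s) //= ffunE eqxx scale1r [X in _ + X]big1 ?addr0 //.
by move=> t /negPf ts; rewrite ffunE ts scale0r.
Qed.

Hypothesis S_square : forall s : S, exists a b : S, s = (a * b)%g.
Hypothesis idem_central :
  forall e s : S, e \in idem S -> (e * s)%g = (s * e)%g.

Lemma pbasisE (s : S) e :
  pbasis s e = cbasis K (None : Htilde0 (val e)) (insub s).
Proof. by rewrite ffunE. Qed.

Lemma insub_mul e (s t : S) : ((insub s : Htilde0 e) * insub t)%g =
  if (plus s == e) && (plus t == e) then insub (s * t)%g else None.
Proof.
rewrite [LHS]/(Htilde0_mul _ _).
case: (insubP {s : S | s \in Htilde e} s) => [s' | ]; rewrite inE.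
  move=> -> ->; case: (insubP {s : S | s \in Htilde e} t) => [t' | ]; rewrite inE.
    by move=> -> ->.
  by move=> /negPf ->.
by move=> /negPf ->.
Qed.

Lemma pbasis_mul (s t : S) : Htilde_alg_mul (pbasis s) (pbasis t) =
  if (plus s == plus (s * t)%g) && (plus t == plus (s * t)%g)
  then pbasis (s * t)%g else 0.
Proof.
apply/ffunP => e; rewrite [LHS]ffunE !pbasisE.
rewrite cbasis_mul; [|by case|by case].
rewrite insub_mul.
have [ste|ste] := eqVneq (plus (s * t)%g) (val e).
  by rewrite ste; case: ifP => _; rewrite ?pbasisE ?dprod0E ?cbasis0.
have -> : (insub (s * t)%g : Htilde0 (val e)) = None by rewrite insubN ?inE.
rewrite if_same cbasis0; case: ifP => _; rewrite ?dprod0E //.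
by rewrite pbasisE insubN ?inE // cbasis0.
Qed.

Lemma pbasis_basis :
  bijective (fun x : salg K S => \sum_s x s *: pbasis s).
Proof.
have pE s : plus s \in idem S by have [] := plusP S_square idem_central s.
have pH (s : S) : s \in Htilde (plus s) by rewrite inE.
pose F (x : salg K S) : Htilde_alg := \sum_s x s *: pbasis s.
have FE x e (u : {u : Htilde0 (val e) | u != None}) :
    F x e u = oapp (x \o val) 0 (val u).
  rewrite dprod_sumE sum_ffunE; case: u => -[u|//] /= uN.
  rewrite (bigD1 (val u)) //= dprodZE pbasisE !ffunE valK eqxx.
  rewrite [_ *: _]mulr1 big1 ?addr0 // => s su.
  rewrite dprodZE pbasisE !ffunE; case: eqP => [us|]; last by rewrite scaler0.
  by case/eqP: su; case: insubP us => // v _ <- [->].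
pose nz s : {u : Htilde0 (plus s) | u != None} :=
  Sub (Some (Sub s (pH s) : {s' : S | s' \in Htilde (plus s)})) isT.
pose G (y : Htilde_alg) : salg K S :=
  [ffun s => y (Sub (plus s) (pE s)) (nz s)].
exists G => [x|y]; first by apply/ffunP => s; rewrite ffunE FE.
apply/ffunP => e; apply/ffunP => u; rewrite [LHS]FE.
case: u => -[[u uH]|//] uN /=; rewrite ffunE /nz.
case: e uH uN => e eE /= uH uN.
have eu : e = plus u by move: uH; rewrite inE => /eqP.
subst e; move: uN; rewrite (bool_irrelevance uH (pH u)) => uN.
by rewrite (bool_irrelevance eE (pE u)) (bool_irrelevance uN isT).
Qed.

End Z.

Definition alg_iso (K : fieldType) (A B : lmodType K)
    (mulA : A -> A -> A) (mulB : B -> B -> B) (f : A -> B) : Prop :=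
  [/\ linear f, {morph f : x y / mulA x y >-> mulB x y} & bijective f].

Definition unital (A : Type) (mulA : A -> A -> A) : Prop :=
  exists u : A, left_id u mulA /\ right_id u mulA.

(* Main.v *)
Require Import Defs.
From HB Require Import structures.
From mathcomp Require Import all_boot all_order all_algebra.

(** Since w <= s iff w = s w^+, the map (u, v) |-> u v is a bijection from the
    pairs with u <= s, v <= t and u^+ = v^+ = (u v)^+ onto the elements below
    s t, with inverse w |-> (s w^+, t w^+); hence Z is multiplicative. It is
    bijective because the zeta transform of a finite poset is, and KS is unital
    because the sum of the idempotents is an identity of the product. *)

Set Implicit Arguments.
Unset Strict Implicit.
Unset Printing Implicit Defensive.

Import GRing.Theory.
Local Open Scope ring_scope.

(** * Bilinearity and identities in contracted algebras *)

(** Takes a bare function with a proof of linearity, so that it applies to multiplication by a fixed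
    element on either side and to [Z]. *)
Lemma linear_sum_scale (K : fieldType) (U V : lmodType K) (f : U -> V)
    (J : Type) (r : seq J) (P : pred J) (c : J -> K) (F : J -> U) :
  linear f ->
  f (\sum_(j <- r | P j) c j *: F j) = \sum_(j <- r | P j) c j *: f (F j).
Proof.
move=> fL.
pose g : {linear U -> V} := HB.pack f (GRing.isLinear.Build K U V *:%R f fL).
rewrite -[f]/(g : U -> V) linear_sum.
by apply: eq_bigr => j _; rewrite linearZ.
Qed.

Section ContractedAlgebra.
Variables (K : fieldType) (T : finMagmaType) (z : T).

Lemma calgE (y : calg K z) : y = \sum_a y a *: cbasis K z (val a).
Proof.
apply/ffunP => u; rewrite sum_ffunE (bigD1 u) //= !ffunE eqxx big1 ?addr0.
  by rewrite [_ *: _]mulr1.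
by move=> t tu; rewrite !ffunE val_eqE eq_sym (negPf tu) scaler0.
Qed.

Lemma calg_mul_linearl (y : calg K z) : linear (@calg_mul K T z ^~ y).
Proof.
move=> k x x'; rewrite /calg_mul scaler_sumr -big_split; apply: eq_bigr => a _.
rewrite scaler_sumr -big_split; apply: eq_bigr => b _ /=.
by rewrite !ffunE scalerA -scalerDl mulrDl mulrA.
Qed.

Lemma calg_mul_linearr (x : calg K z) : linear (@calg_mul K T z x).
Proof.
move=> k y y'; rewrite /calg_mul scaler_sumr -big_split; apply: eq_bigr => a _.
rewrite scaler_sumr -big_split; apply: eq_bigr => b _ /=.
by rewrite !ffunE scalerA -scalerDl mulrDr mulrCA.
Qed.

Hypotheses (mul0z : forall t : T, (z * t)%g = z)
  (mulz0 : forall t : T, (t * z)%g = z).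

(** By linearity it is enough to compare both sides on the elements [cbasis K z (val a)]. *)
Lemma calg_mul1l (u : T) : (forall t : T, (u * t)%g = t) ->
  left_id (cbasis K z u) (@calg_mul K T z).
Proof.
move=> u1 y; rewrite {1}[y]calgE (linear_sum_scale _ _ _ _ (calg_mul_linearr _)).
by rewrite [RHS]calgE; apply: eq_bigr => a _; rewrite cbasis_mul // u1.
Qed.

Lemma calg_mul1r (u : T) : (forall t : T, (t * u)%g = t) ->
  right_id (cbasis K z u) (@calg_mul K T z).
Proof.
move=> u1 y.
rewrite {1}[y]calgE (linear_sum_scale _ _ _ _ (calg_mul_linearl (cbasis K z u))).
by rewrite [RHS]calgE; apply: eq_bigr => a _; rewrite cbasis_mul // u1.
Qed.

End ContractedAlgebra.

(** * The zeta transform of a finite poset *)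

Section Zeta.
Variables (K : fieldType) (T : finType) (le : rel T).

(** This is the coefficient of t in the image of x under the linear extension of s |-> sum of the t
    <= s, so the sum runs over the elements above t. *)
Definition zeta (x : {ffun T -> K^o}) : {ffun T -> K^o} :=
  [ffun t => \sum_(s | le t s) x s].

Lemma zeta_linear : linear zeta.
Proof.
move=> k x y; apply/ffunP => t; rewrite !ffunE scaler_sumr -big_split.
by apply: eq_bigr => s _; rewrite !ffunE.
Qed.

HB.instance Definition _ :=
  GRing.isLinear.Build K {ffun T -> K^o} {ffun T -> K^o} *:%R zeta zeta_linear.

Hypotheses (le_refl : reflexive le) (le_anti : antisymmetric le)
  (le_trans : transitive le).

(* At a maximal element of the support of x, zeta x takes the value of x. *)
Lemma zeta_eq0 x : zeta x = 0 -> x = 0.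
Proof.
move=> zx0; apply/eqP; apply: contraT => x0.
have [s0 s0x] : exists s, x s != 0.
  apply/existsP; move: x0; apply: contraNT => /existsPn x0.
  by apply/eqP/ffunP => s; rewrite ffunE; apply/eqP; have := x0 s; rewrite negbK.
pose up s := [set r | le s r].
(* Having the fewest elements above it makes s maximal in the support: a strictly larger r has a
   strictly smaller up-set. *)
case: (@arg_minnP _ s0 (fun s => x s != 0) (fun s => #|up s|) s0x) => s sx smin.
move/ffunP/(_ s): zx0; rewrite !ffunE (bigD1 s) //= big1 ?addr0 => [xs|r].
  by rewrite xs eqxx in sx.
move=> /andP[sr rs]; apply/eqP; apply: contraT => /smin.
rewrite leqNgt proper_card // properE; apply/andP; split.
  by apply/subsetP => q; rewrite !inE; apply: le_trans.
apply/subsetPn; exists s; rewrite !inE ?le_refl //.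
by apply: contra rs => rs; rewrite (@le_anti r s) ?rs.
Qed.

(** Injectivity suffices, since [zeta] is an endomorphism of a finite-dimensional space. *)
Lemma zeta_bij : bijective zeta.
Proof.
pose f := linfun zeta.
have fE x : f x = zeta x by rewrite lfunE.
have f0 : lker f == 0%VS.
  apply/lker0P => x y; rewrite !fE => /eqP.
  by rewrite -subr_eq0 -linearB => /eqP /zeta_eq0 /eqP; rewrite subr_eq0 => /eqP.
by exists (f^-1)%VF => x; rewrite -fE ?lker0_lfunK ?lker0_lfunVK.
Qed.

End Zeta.

(** * The natural partial order and factorizations below a product *)

Section NaturalOrder.
Variable S : finSemigroupType.
Hypothesis S_square : forall s : S, exists a b : S, s = (a * b)%g.
Hypothesis idem_central :
  forall e s : S, e \in idem S -> (e * s)%g = (s * e)%g.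

Let plus_in (s : S) : plus s \in idem S.
Proof. by have [] := plusP S_square idem_central s. Qed.

Let mul_plus (s : S) : (s * plus s)%g = s.
Proof. by have [] := plusP S_square idem_central s. Qed.

Lemma idem_mul (e : S) : e \in idem S -> (e * e)%g = e.
Proof. by rewrite inE => /eqP. Qed.

(** If w = s e, then w e = w, so w^+ <= e and w = w w^+ = s e w^+ = s w^+. This replaces the
    existential idempotent by a canonical one. *)
Lemma sle_plus (w s : S) : sle w s = (w == s * plus w)%g.
Proof.
apply/idP/eqP => [/exists_inP[e eE /eqP we]|->]; last first.
  by apply/exists_inP; exists (plus w).
have [_ _ /(_ e eE)] := plusP S_square idem_central w.
rewrite {1}we -mulgA idem_mul // => /(_ (esym we)) /(idem_leP idem_central) ep.
by rewrite -[LHS]mul_plus {1}we -mulgA ep.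
Qed.

Lemma sle_refl : reflexive (@sle S).
Proof. by move=> s; rewrite sle_plus mul_plus. Qed.

(** If s = t e and t = s f, then s = s f e = s e f = s f = t. *)
Lemma sle_anti : antisymmetric (@sle S).
Proof.
move=> s t /andP[/exists_inP[e eE /eqP se] /exists_inP[f fE /eqP tf]].
have s_e : (s * e)%g = s by rewrite {1}se -mulgA idem_mul // -se.
by rewrite {1}se {1}tf -mulgA (idem_central e fE) mulgA s_e -tf.
Qed.

(** From s = t s^+ follows s^+ <= t^+, so t = r t^+ gives s = r t^+ s^+ = r s^+. *)
Lemma sle_trans : transitive (@sle S).
Proof.
move=> t s r; rewrite (sle_plus s t) => /eqP st; rewrite sle_plus => /eqP tr.
rewrite sle_plus; apply/eqP; rewrite {1}st {1}tr -mulgA; congr (_ * _)%g.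
by apply/(idem_leP idem_central) => //; rewrite {1}st; apply: plus_mull.
Qed.

(** Minimality of u^+ gives u^+ <= w^+. The lemma is applied to a product w and each of its factors
    u, where w^+ <= u^+ always holds. *)
Lemma plus_eq (u w : S) :
  idem_le (plus w) (plus u) -> (u * plus w)%g = u -> plus u = plus w.
Proof.
move=> wu uw; apply: (idem_le_anti idem_central) => //.
by have [_ _ umin] := plusP S_square idem_central u; apply: umin.
Qed.

Lemma mul_cut (s t e : S) : e \in idem S ->
  ((s * e) * (t * e))%g = (s * t * e)%g.
Proof.
by move=> eE; rewrite mulgA -(mulgA s) (idem_central t eE) mulgA -mulgA idem_mul.
Qed.

Lemma mul_factor (s t w : S) : sle w (s * t)%g ->
  ((s * plus w) * (t * plus w))%g = w.
Proof. by rewrite sle_plus mul_cut // => /eqP <-. Qed.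

(** The left side is the filter that reindexing by w = u v produces; the right side is the one from
    multiplying two sums of basis elements. With e = (u v)^+, u = s e gives u e = u, hence u^+ = e,
    and likewise for v; conversely u v = s e t e = s t e. *)
Lemma sle_mulE (s t u v : S) :
  sle (u * v)%g (s * t)%g &&
    ((s * plus (u * v), t * plus (u * v))%g == (u, v)) =
  (sle u s && sle v t) &&
    ((plus u == plus (u * v)%g) && (plus v == plus (u * v)%g)).
Proof.
rewrite !sle_plus xpair_eqE; set e := plus (u * v)%g.
have eE : e \in idem S by apply: plus_in.
apply/idP/idP => [/and3P[_ /eqP ue /eqP ve]|].
  have -> : plus u = e.
    by apply: plus_eq; [apply: plus_mull | rewrite -{1}ue -mulgA idem_mul].
  have -> : plus v = e.
    by apply: plus_eq; [apply: plus_mulr | rewrite -{1}ve -mulgA idem_mul].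
  by rewrite ue ve !eqxx.
move=> /andP[/andP[us vt] /andP[/eqP ue /eqP ve]].
move: us vt; rewrite ue ve => /eqP us /eqP vt.
by rewrite -us -vt !eqxx !andbT -(mul_cut s t eE) -us -vt.
Qed.

End NaturalOrder.

(** * Linearity, bijectivity and multiplicativity of [Z] *)

Section Z.
Variables (K : fieldType) (S : finSemigroupType).

Lemma Htilde_alg_mul_linearl (y : Htilde_alg K S) :
  linear (@Htilde_alg_mul K S ^~ y).
Proof.
move=> k x x'; apply/ffunP => e.
by rewrite [LHS]ffunE !dprodDE !dprodZE calg_mul_linearl ![Htilde_alg_mul _ _ e]ffunE.
Qed.

Lemma Htilde_alg_mul_linearr (x : Htilde_alg K S) :
  linear (@Htilde_alg_mul K S x).
Proof.
move=> k y y'; apply/ffunP => e.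
by rewrite [LHS]ffunE !dprodDE !dprodZE calg_mul_linearr ![Htilde_alg_mul _ _ e]ffunE.
Qed.

Lemma Z_linear : linear (@Z K S).
Proof.
move=> k x y; rewrite /Z scaler_sumr -big_split; apply: eq_bigr => s _ /=.
by rewrite !ffunE scalerA -scalerDl.
Qed.

(** Exchanging the two sums factors [Z] through the zeta transform of [sle], followed by the
    coordinate map of the basis [pbasis]. *)
Lemma Z_zeta (x : salg K S) :
  Z x = \sum_t (zeta (@sle S) x t : K) *: pbasis K t.
Proof.
rewrite /Z; under eq_bigr do rewrite scaler_sumr big_mkcond.
rewrite exchange_big; apply: eq_bigr => t _ /=.
by rewrite ffunE scaler_suml [RHS]big_mkcond.
Qed.

Hypothesis S_square : forall s : S, exists a b : S, s = (a * b)%g.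
Hypothesis idem_central :
  forall e s : S, e \in idem S -> (e * s)%g = (s * e)%g.

Lemma Z_bij : bijective (@Z K S).
Proof.
have zB := zeta_bij K (sle_refl S_square idem_central)
  (sle_anti idem_central) (sle_trans S_square idem_central).
apply: (eq_bij (bij_comp (pbasis_basis K S_square idem_central) zB)) => x.
by rewrite Z_zeta.
Qed.

Lemma Z_sbasis_mul (s t : S) :
  Htilde_alg_mul (Z (sbasis K s)) (Z (sbasis K t)) = Z (sbasis K (s * t)%g).
Proof.
rewrite !Z_sbasis.
(* Coefficients 1 bring the sums into the form that [linear_sum_scale] expects. *)
under eq_bigr do rewrite -[pbasis K _]scale1r.
rewrite (linear_sum_scale _ _ _ _ (Htilde_alg_mul_linearl _)).
under eq_bigr => u _.
  rewrite scale1r; under eq_bigr do rewrite -[pbasis K _]scale1r.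
  rewrite (linear_sum_scale _ _ _ _ (Htilde_alg_mul_linearr _)).
  under eq_bigr do rewrite scale1r pbasis_mul.
  over.
rewrite pair_big /= -big_mkcondr /=.
(* The elements w below s t are replaced by the pairs (u, v) with u v = w, with inverse w |-> (s
   w^+, t w^+). *)
rewrite [RHS](reindex_onto (fun p => p.1 * p.2)%g
  (fun w => (s * plus w, t * plus w)%g)); last exact: mul_factor.
by apply: eq_bigl => -[u v]; rewrite /= sle_mulE.
Qed.

(** Both sides are bilinear in x and y, which reduces the claim to [Z_sbasis_mul]. *)
Lemma Z_mul : {morph @Z K S : x y / salg_mul x y >-> Htilde_alg_mul x y}.
Proof.
move=> x y; rewrite {2}[x]salgE {2}[y]salgE /salg_mul.
rewrite !(linear_sum_scale _ _ _ _ Z_linear).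
rewrite (linear_sum_scale _ _ _ _ (Htilde_alg_mul_linearl _)).
under eq_bigr do rewrite -[\sum_b _]scale1r.
rewrite (linear_sum_scale _ _ _ _ Z_linear); apply: eq_bigr => a _.
rewrite scale1r (linear_sum_scale _ _ _ _ Z_linear).
rewrite (linear_sum_scale _ _ _ _ (Htilde_alg_mul_linearr _)) scaler_sumr.
by apply: eq_bigr => b _; rewrite scalerA Z_sbasis_mul.
Qed.

Lemma Htilde_alg_unital : unital (@Htilde_alg_mul K S).
Proof.
(* The component at e is the identity e of the monoid [Htilde0 e]; here [insub] does not give the
   zero, because e^+ = e. *)
exists [ffun e => cbasis K (None : Htilde0 (val e)) (insub (val e))].
split=> y; apply/ffunP => e; rewrite !ffunE.
  rewrite calg_mul1l //; first by case.
  by have [] := Htilde0_mule S_square idem_central (valP e).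
rewrite calg_mul1r //; first by case.
by have [] := Htilde0_mule S_square idem_central (valP e).
Qed.

End Z.

(** * Transfer of the identity and the isomorphism *)

Lemma unital_bij (A B : Type) (mulA : A -> A -> A) (mulB : B -> B -> B)
    (f : A -> B) :
  {morph f : x y / mulA x y >-> mulB x y} -> bijective f ->
  unital mulB -> unital mulA.
Proof.
move=> fM [g fK gK] [u [u1l u1r]]; exists (g u).
by split=> x; apply: (can_inj fK); rewrite fM gK.
Qed.

Theorem theorem6p5 (K : fieldType) (S : finSemigroupType)
    (S_square : forall s : S, exists a b : S, s = (a * b)%g)
    (idem_central : forall e s : S, e \in idem S -> (e * s)%g = (s * e)%g) :
  alg_iso (@salg_mul K S) (@Htilde_alg_mul K S) (@Z K S)
  /\ unital (@salg_mul K S).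
Proof.
have ZM := @Z_mul K S S_square idem_central.
have ZB := Z_bij K S_square idem_central.
split; first by split=> //; exact: Z_linear.
exact: unital_bij ZM ZB (Htilde_alg_unital K S_square idem_central).
Qed.
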